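(* Consider a system $$q'=p,\qquad p'=\frac{3q^5}{64}+\sum_{k=-3}^{4}a_k(t)\,q^k$$ with coefficient functions $a_k(t)$, where $a_{-3}\neq0$. If this system is quadratic regularisable on a bundle of rational surfaces obtained by blowing up points in the same configuration as the surface $\mathcal X^{\mathrm{Tak}}$ (described in the context), then it must coincide, up to affine changes of the independent variable, with the Takasaki system $$q'=p,\qquad p'=\frac{8\beta}{q^3}+(t^2-\alpha)q+\frac t2q^3+\frac3{64}q^5,$$ where $\alpha,\beta$ are complex parameters.
   Context: Quadratic regularisability: a first-order system for $(u(t),v(t))$ is quadratic regularisable in the variable $v$ if it has the form $u'=R_1(t,u,v^2)$, $v'=\frac1vR_2(t,u,v^2)$, where $R_1(t,x,y),R_2(t,x,y)$ are rational functions of their arguments, both regular in $y$, with $R_2(t,x,y)$ nonzero at $y=0$. (With $h=v^2$ the system becomes $u'=R_1(t,u,h)$, $h'=2R_2(t,u,h)$, which is regular in $h$ at $h=0$.) Blow-up convention: after blowing up a point given in an affine chart by $(x,y)=(x^*,y^* )$ (the coordinates of the centre may depend on $t$), the $i$-th exceptional curve is covered by charts $(u_i,v_i)$ and $(U_i,V_i)$ with $x-x^*=u_iv_i,\ y-y^*=v_i$ and $x-x^*=V_i,\ y-y^*=U_iV_i$. Configuration of $\mathcal X^{\mathrm{Tak}}$: compactify $\mathbb C^2_{q,p}$ to $\mathbb P^1\times\mathbb P^1$ with $Q=1/q$, $P=1/p$, and blow up twenty points $q_1,\dots,q_{20}$, which are the points of indeterminacy of the system, arranged as follows ($q_i\leftarrow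 q_j$ means that $q_j$ lies on the exceptional curve of $q_i$): $q_1:(q,P)=(0,0)$; two distinct points $q_2,q_4$ on the exceptional curve of $q_1$, each of the form $(u_1,v_1)=( *,0)$; one point $q_3:(u_2,v_2)=( *,0)$ over $q_2$ and one point $q_5:(u_4,v_4)=( *,0)$ over $q_4$; $q_6:(Q,P)=(0,0)\leftarrow q_7:(U_6,V_6)=(0,0)\leftarrow q_8:(u_7,v_7)=(0,0)$; two distinct points $q_9:(u_8,v_8)=(8,0)$ and $q_{15}:(u_8,v_8)=(-8,0)$ over $q_8$; and chains $q_9\leftarrow q_{10}\leftarrow\cdots\leftarrow q_{14}$ and $q_{15}\leftarrow q_{16}\leftarrow\cdots\leftarrow q_{20}$, each further point $q_{i+1}$ of a chain being of the form $(u_i,v_i)=( *,0)$. Here $*$ stands for functions of $t$ determined by the $a_k$ and their derivatives. The system is quadratic regularisable on the resulting bundle if, for $i=3,5,14,20$, the system rewritten in the chart $(u_i,v_i)$ covering the last exceptional curves is quadratic regularisable in $v_i$.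
   Formalization: The system is shown to be the Takasaki system with λt+μ in place of t, where λ=0 (autonomous, e.g. q''=3q^5/64+a/q^3) can occur; for λ≠0 an invertible affine change of t, together with constant rescalings of q and p, gives a Takasaki system. *)

(* Defs.v *)
From HB Require Import structures.
From mathcomp Require Import all_boot all_order all_algebra.
From mathcomp Require Import all_classical all_reals all_analysis.
From mathcomp Require Import complex.

Set Implicit Arguments.
Unset Strict Implicit.
Unset Printing Implicit Defensive.

Import Order.TTheory GRing.Theory Num.Theory.
Import numFieldNormedType.Exports.

Local Open Scope classical_set_scope.
Local Open Scope ring_scope.

(* The analytic structure of the complex numbers R[i] is carried by its
   regular alias (R[i])^o; derivatives in direction 1 over the field R[i] are
   complex derivatives. *)

Section Takasaki.
Variable R : realType.
Local Notation C := R[i].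

Definition holomorphic_on (D : set C^o) (f : C -> C) : Prop :=
  forall t : C, D t -> derivable (f : C^o -> C^o) (t : C^o) (1 : C^o).

(* F t (q, p) is the right-hand side of (q', p') = F t (q, p). *)
Definition system := C -> C * C -> C * C.

Definition second_order (f : C -> C -> C) : system :=
  fun t z => (z.2, f t z.1).

Definition laurent_rhs (a : int -> C -> C) (t q : C) : C :=
  3 * q ^+ 5 / 64 + \sum_(i < 8) a (i%:Z - 3) t * q ^ (i%:Z - 3).

Definition takasaki_rhs (alpha beta t q : C) : C :=
  8 * beta / q ^+ 3 + (t ^+ 2 - alpha) * q + t / 2 * q ^+ 3
  + 3 / 64 * q ^+ 5.

(* An element of C(x, y), as a numerator and a denominator in C[x][y]: the
   outer variable is y, so that p.[0] is the polynomial p(x, 0) in x. *)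
Definition ratfun : Type := {poly {poly C}} * {poly {poly C}}.

Definition eval2 (p : {poly {poly C}}) (x y : C) : C := p.[y%:P].[x].

Definition rateval (r : ratfun) (x y : C) : C :=
  eval2 r.1 x y / eval2 r.2 x y.

(* No pole along y = 0. *)
Definition regular_in_y (r : ratfun) : Prop := r.2.[0] != 0.

(* For r regular in y: r(x, 0) is a nonzero element of C(x). *)
Definition nonzero_at_y0 (r : ratfun) : Prop := r.1.[0] != 0.

(* phi t (u, v) = (q, p) is a t-dependent chart. The vector w = (u', v') is
   the velocity at (t, z) of the system F rewritten in the chart iff the
   derivative of s |-> phi s (u, v) along (1, u', v') is F, i.e.
     phi_t + phi_u u' + phi_v v' = F t (phi t (u, v)). *)
Definition chart_velocity (F : system) (phi : C -> C * C -> C * C)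
    (t : C) (z w : C * C) : Prop :=
  let path s := phi s (z.1 + (s - t) * w.1, z.2 + (s - t) * w.2) in
  is_derive (t : C^o) (1 : C^o)
    ((fun s => (path s).1) : C^o -> C^o) (F t (phi t z)).1 /\
  is_derive (t : C^o) (1 : C^o)
    ((fun s => (path s).2) : C^o -> C^o) (F t (phi t z)).2.

(* The system F, rewritten in the chart phi, has the form
     u' = R1(t, u, v^2), v' = R2(t, u, v^2) / v.
   The equality is one of rational functions of (u, v), so it is required only
   where all expressions make sense; as 0^-1 = 0, the points with q and p
   both nonzero are those where no inverse in phi is taken at 0 and the powers
   of q in F are defined. *)
Definition quadratic_regularisable (D : set C^o) (F : system)
    (phi : C -> C * C -> C * C) : Prop :=
  exists R1 R2 : C -> ratfun, forall t : C, D t ->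
    [/\ regular_in_y (R1 t), regular_in_y (R2 t), nonzero_at_y0 (R2 t) &
      forall u v : C, v != 0 ->
        (phi t (u, v)).1 != 0 -> (phi t (u, v)).2 != 0 ->
        eval2 (R1 t).2 u (v ^+ 2) != 0 -> eval2 (R2 t).2 u (v ^+ 2) != 0 ->
        chart_velocity F phi t (u, v)
          (rateval (R1 t) u (v ^+ 2), v^-1 * rateval (R2 t) u (v ^+ 2))].

Definition blow_uv (ctr w : C * C) : C * C :=
  (ctr.1 + w.1 * w.2, ctr.2 + w.2).

Definition blow_UV (ctr w : C * C) : C * C :=
  (ctr.1 + w.2, ctr.2 + w.1 * w.2).

(* Successive blow-ups in (u, v) charts with centres (x, 0), x in xs, the
   first element of xs being the first point blown up. *)
Definition tower (xs : seq C) (w : C * C) : C * C :=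
  foldr (fun x => blow_uv (x, 0)) w xs.

Definition from_qP (z : C * C) : C * C := (z.1, z.2^-1).
Definition from_QP (z : C * C) : C * C := (z.1^-1, z.2^-1).

(* With q_i <- q_j meaning that q_j lies on the exceptional curve of q_i, the
   twenty centres are, in the compactification with Q = 1/q and P = 1/p,
     q_1 : (q, P) = (0, 0),  q_1 <- q_2 <- q_3,  q_1 <- q_4 <- q_5,
     q_6 : (Q, P) = (0, 0) <- q_7 <- q_8,
     q_8 <- q_9 <- ... <- q_14,  q_8 <- q_15 <- ... <- q_20.
   The centre q_7 is the origin of the (U, V) chart over q_6; any other
   q_j over q_i is (u_i, v_i) = ( *, 0), where * is 0 for q_8, 8 for q_9,
   -8 for q_15, and the function c j t otherwise. The chart numbered i below
   is (u_i, v_i) |-> (q, p). *)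
Definition chart3 (c : nat -> C -> C) (t : C) (w : C * C) : C * C :=
  from_qP (tower [:: 0; c 2%N t; c 3%N t] w).

Definition chart5 (c : nat -> C -> C) (t : C) (w : C * C) : C * C :=
  from_qP (tower [:: 0; c 4%N t; c 5%N t] w).

Definition chart14 (c : nat -> C -> C) (t : C) (w : C * C) : C * C :=
  from_QP (blow_UV (0, 0)
    (tower [:: 0; 0; 8; c 10%N t; c 11%N t; c 12%N t; c 13%N t; c 14%N t] w)).

Definition chart20 (c : nat -> C -> C) (t : C) (w : C * C) : C * C :=
  from_QP (blow_UV (0, 0)
    (tower [:: 0; 0; - 8; c 16%N t; c 17%N t; c 18%N t; c 19%N t; c 20%N t] w)).

Definition quadratic_regularisable_on_Takasaki_configuration
    (D : set C^o) (F : system) : Prop :=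
  exists c : nat -> C -> C,
    [/\ forall i, holomorphic_on D (c i),
        forall t, D t -> c 2%N t != c 4%N t &
        [/\ quadratic_regularisable D F (chart3 c),
            quadratic_regularisable D F (chart5 c),
            quadratic_regularisable D F (chart14 c) &
            quadratic_regularisable D F (chart20 c)]].

(* The affine change t = r s + m of the independent variable, together with
   the rescaling q = k x, p = l y, transforms (q', p') = F t (q, p) into
   (dx/ds, dy/ds) = G s (x, y). *)
Definition affinely_equivalent (D : set C^o) (F G : system) : Prop :=
  exists r m k l : C, [/\ r != 0, k != 0, l != 0 &
    forall s x y : C, D (r * s + m) -> x != 0 ->
      (r / k * (F (r * s + m) (k * x, l * y)).1,
       r / l * (F (r * s + m) (k * x, l * y)).2) = G s (x, y)].

End Takasaki.

(* Main.v *)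
Require Import Defs.
From mathcomp Require Import all_boot all_order all_algebra.
From mathcomp Require Import all_classical all_reals all_analysis.
From mathcomp Require Import complex ring.
Import Order.TTheory GRing.Theory Num.Theory.
Import numFieldNormedType.Exports.
Set Implicit Arguments.
Unset Strict Implicit.
Unset Printing Implicit Defensive.
Local Open Scope classical_set_scope.
Local Open Scope ring_scope.

(** For fixed [t] and a fixed generic [u], regularisability in a chart says that
    certain identities between polynomials in [v] hold outside a finite set, so
    they hold identically and can be split into their even and odd parts.

    At infinity [q = 1 / v] and [p = 1 / (v^3 U)] with
    [U = e + k1 v + ... + k5 v^5 + u v^6] and [e = 8] or [e = - 8]. Since
    [v v' = - 1 / U] is even in [v], the odd centres [k1], [k3], [k5] vanish; the
    odd part of the equation for [u'] then kills [a_{-2}], [a_0], [a_2], [a_4],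
    and its even part is divisible by [v^8], which determines [k2] and [k4] in
    terms of [a_3] and [a_1] and leaves one compatibility condition.

    Near [q = 0] a chart gives [a_{-3} = - x^2] and [a_{-1} = x'], where [x] is
    [c_2] or [c_4]. Hence [c_4 = - c_2], so [a_{-1} = 0] and [a_{-3}] is locally
    constant. The two compatibility conditions at infinity then say that [a_3']
    and [a_1 - 4 a_3^2] have zero derivative, and [D] is connected. *)

(** * Functions with zero derivative *)

Section ZeroDerivative.
Variable R : realType.
Local Notation C := R[i].

(** The direction is [1], but the increment [k] is a complex scalar, so one bound covers all
    directions of the plane. This permits restriction to real lines. *)
Lemma is_derive0_small {f : C^o -> C^o} {z : C^o} {e : R} :
  is_derive z (1 : C^o) f 0 -> 0 < e ->
  exists2 d : R, 0 < d &
    forall k : C, `|k| < d%:C%C -> `|f (z + k) - f z| <= e%:C%C * `|k|.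
Proof.
move=> [df f'0] e0.
have H0 :
  (fun h : C^o => h^-1 *: ((f \o shift z) (h *: (1 : C^o)) - f z)) @ 0^' -->
  ('D_(1 : C^o) f z) by exact: df.
move: H0; rewrite f'0 {df f'0}.
move/cvgr0Pnorm_le => /(_ e%:C%C); rewrite ltcR => /(_ e0).
case=> /= d d0 H; exists (complex.Re d).
  by move: d0; rewrite ltcE /= => /andP[].
have dE : (complex.Re d)%:C%C = d by apply: RRe_real; rewrite ger0_real// ltW.
rewrite dE => k kd.
have [->|k0] := eqVneq k 0; first by rewrite addr0 subrr normr0 mulr0.
have /= := H k; rewrite sub0r normrN => /(_ kd k0).
rewrite [k%:A]mulr1 [k + z]addrC [_ *: _]/( _ * _) normrM normfV.
by rewrite mulrC ler_pdivrMr ?normr_gt0.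
Qed.

Lemma is_derive0_Re_line {f : C^o -> C^o} {z w : C} {s : R} :
  is_derive (z + s%:C%C * w : C^o) (1 : C^o) f 0 ->
  is_derive s (1 : R) (fun s : R => complex.Re (f (z + s%:C%C * w)) : R) 0.
Proof.
move=> df; set g := fun s : R => _.
have H :
    (fun h : R => h^-1 *: ((g \o shift s) (h *: 1) - g s)) @ 0^' --> (0 : R).
  apply/cvgr0Pnorm_le => e e0.
  (* Dividing by [|w| + 1] rather than [|w|] keeps the case [w = 0]. *)
  have W0 : 0 < complex.Re `|w| + 1.
    by rewrite normc_def /= ltr_wpDl ?sqrtr_ge0.
  have [d d0 Hd] := is_derive0_small df (divr_gt0 e0 W0).
  exists (d / (complex.Re `|w| + 1)) => /=; first exact: divr_gt0.
  move=> h /=; rewrite sub0r normrN => hd h0.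
  rewrite [_ *: _]/( _ * _) normrM normfV mulrC ler_pdivrMr ?normr_gt0//.
  rewrite /g /= [h *: 1]mulr1 -raddfB -lecR.
  have wE : (complex.Re `|w|)%:C%C = `|w| by rewrite normc_def.
  have nh : `|h%:C%C| = (`|h|)%:C%C :> C.
    by rewrite normc_def /= expr0n addr0 sqrtr_sqr.
  have -> : z + (h + s)%:C%C * w = z + s%:C%C * w + h%:C%C * w.
    by rewrite rmorphD mulrDl addrCA addrA [z + _ + _]addrC addrA addrC.
  apply: le_trans (normc_ge_Re _) _; apply: le_trans (Hd _ _) _.
    rewrite normrM nh -wE -rmorphM ltcR.
    move: hd; rewrite ltr_pdivlMr// => /(le_lt_trans _); apply.
    by apply: ler_wpM2l; rewrite ?lerDl.
  rewrite normrM nh -wE -!rmorphM lecR mulrCA mulrC ler_wpM2r//.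
  by rewrite mulrAC ler_pdivrMr//; apply: ler_wpM2l; rewrite ?lerDl ?ltW.
have dg : derivable g s 1 by apply/cvg_ex; exists 0; exact: H.
by apply: DeriveDef => //; exact: (cvg_lim _ H).
Qed.

Lemma derive0_segment_Re (f : C^o -> C^o) (z w : C) :
  (forall s : R, s \in `[0, 1]%R ->
    is_derive (z + s%:C%C * w : C^o) (1 : C^o) f 0) ->
  complex.Re (f (z + w)) = complex.Re (f z).
Proof.
move=> df; pose g (s : R) : R := complex.Re (f (z + s%:C%C * w)).
have dg (s : R) : s \in `[0, 1]%R -> is_derive s (1 : R) g 0.
  by move=> s01; exact: is_derive0_Re_line (df _ s01).
have cg : {within `[0, 1], continuous g}.
  by apply: derivable_within_continuous => x x01; have [] := dg x x01.
have dg' (x : R) : x \in `]0, 1[%R -> is_derive x (1 : R) g 0.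
  by move=> x01; apply: dg; apply: subset_itv_oo_cc x01.
have [c _] := @MVT_segment R g (fun=> 0) 0 1 ler01 dg' cg.
by rewrite mul0r /g mul1r mul0r addr0 => /eqP; rewrite subr_eq0 => /eqP.
Qed.

(** The mean value theorem is a statement on real-valued functions, so the imaginary part is reached
    through [Re (i f) = - Im f]. *)
Lemma derive0_segment (f : C^o -> C^o) (z w : C) :
  (forall s : R, s \in `[0, 1]%R ->
    is_derive (z + s%:C%C * w : C^o) (1 : C^o) f 0) ->
  f (z + w) = f z.
Proof.
move=> df; apply/eqP; rewrite eq_complex derive0_segment_Re// eqxx /=.
have : complex.Re (('i%C : C) * f (z + w)) = complex.Re ('i%C * f z).
  apply: (@derive0_segment_Re ('i%C \*: f)) => s /df dfs.
  have := @is_deriveZ _ (C^o) (C^o) f ('i%C : C) _ _ _ dfs.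
  by rewrite scaler0.
rewrite ![_ * f _]mulrC !ReiNIm => /oppr_inj ->; exact: eqxx.
Qed.

(** Segments inside balls give local constancy. A level set of [f] in [D] and its complement in [D]
    are then both open. *)
Lemma derive0_connected (D : set C^o) (f : C^o -> C^o) :
  open D -> connected D ->
  (forall t, D t -> is_derive t (1 : C^o) f 0) ->
  forall s t, D s -> D t -> f s = f t.
Proof.
move=> oD cD df s t Ds Dt.
have loc z : D z -> \forall y \near z, D y /\ f y = f z.
  move=> Dz; have /nbhs_ballP[e /= e0 zD] : nbhs z D by exact: open_nbhs_nbhs.
  apply/nbhs_ballP; exists e => //= y zy; split; first exact: zD.
  have -> : y = z + (y - z) by rewrite addrC subrK.
  apply: derive0_segment => r; rewrite in_itv /= => /andP[r0 r1].
  apply/df/zD; move: zy; rewrite -!ball_normE /ball_ /= => zy.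
  rewrite opprD addrA subrr sub0r normrN normrM distrC.
  apply: le_lt_trans zy; rewrite -[leRHS]mul1r ler_wpM2r// normc_def /=.
  rewrite expr0n addr0 sqrtr_sqr.
  by rewrite lecR ger0_norm.
pose A := [set z | D z /\ f z = f t].
have oA : open A.
  rewrite openE => z [Dz fz]; rewrite /interior.
  by move: (loc z Dz); apply: filterS => y [Dy fy]; split => //; rewrite fy.
have oB : open [set z | D z /\ f z <> f t].
  rewrite openE => z [Dz fz]; rewrite /interior.
  by move: (loc z Dz); apply: filterS => y [Dy fy]; split => //; rewrite fy.
have : A = D; last by move=> AD; move: Ds; rewrite -AD => -[].
apply: cD; first by exists t.
  by exists A => //; apply/seteqP; split => [z|z []//] [Dz fz].
exists (~` [set z | D z /\ f z <> f t]); first exact: open_closedC.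
apply/seteqP; split => z.
  by move=> [Dz fz]; split => // -[].
by move=> [Dz /= nfz]; split => //; apply: contrapT => fz; exact: nfz.
Qed.

End ZeroDerivative.

(** * Regularisability as polynomial identities *)

Section Poly.
Variable K : numFieldType.

(** The factor [Z] absorbs the excluded points: [P * Z] vanishes at every natural number, and in
    characteristic 0 these are too many roots. *)
Lemma poly_eq0_cofinite (P Z : {poly K}) :
  Z != 0 -> (forall v, Z.[v] != 0 -> P.[v] = 0) -> P = 0.
Proof.
move=> Z0 PZ.
suff : P * Z = 0 by move/eqP; rewrite mulf_eq0 (negPf Z0) orbF => /eqP.
apply: (@roots_geq_poly_eq0 _ _ [seq i%:R | i <- iota 0 (size (P * Z))]).
- apply/allP => x _; rewrite rootE hornerM.
  by have [->|/PZ ->] := eqVneq Z.[x] 0; rewrite ?mulr0 ?mul0r.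
- by rewrite map_inj_uniq ?iota_uniq// => m n /eqP; rewrite eqr_nat => /eqP.
- by rewrite size_map size_iota.
Qed.

(** [A] contributes only to even degrees and [B] only to odd ones, so nothing can cancel between
    them. *)
Lemma poly_even_odd_eq0 (A B Z : {poly K}) :
  Z != 0 -> (forall v, Z.[v] != 0 -> A.[v ^+ 2] + v * B.[v ^+ 2] = 0) ->
  A = 0 /\ B = 0.
Proof.
move=> Z0 AB.
have P0 : (A \Po 'X^2) + (B \Po 'X^2) * 'X = 0.
  apply: (@poly_eq0_cofinite _ Z) => // v /AB.
  by rewrite hornerD hornerM !horner_comp !hornerE mulrC.
have c i : ((A \Po 'X^2) + (B \Po 'X^2) * 'X)`_i = 0 by rewrite P0 coef0.
split; apply/polyP => i; rewrite coef0.
  have := c i.*2; rewrite coefD coefMX !coef_comp_poly_Xn//.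
  rewrite dvdn2 odd_double -muln2 mulnK//.
  case: i => [|i]; first by rewrite addr0.
  by rewrite mulSn /= dvdn2 oddS muln2 odd_double /= addr0.
have := c i.*2.+1; rewrite coefD coefMX !coef_comp_poly_Xn//.
by rewrite !dvdn2 /= odd_double /= add0r -muln2 mulnK.
Qed.

(** With nonzero constant term [d] is invertible as a power series, so divisibility by ['X^n] passes
    from [d * G] to [G]. *)
Lemma coefM_Xn_eq0 (d G H : {poly K}) n i :
  d`_0 != 0 -> d * G = 'X^n * H -> (i < n)%N -> G`_i = 0.
Proof.
move=> d0 dG; elim/ltn_ind: i => i IH ltin.
have := congr1 (fun p : {poly K} => p`_i) dG.
rewrite /= coefXnM ltin coefM big_ord_recl subn0 big1 ?addr0; last first.
  move=> j _; rewrite [G`_ _]IH ?mulr0//= /bump /=.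
    by rewrite ltn_subrL /= (leq_ltn_trans _ (ltn_ord j)).
  by apply: leq_ltn_trans ltin; exact: leq_subr.
by move/eqP; rewrite mulf_eq0 (negPf d0) => /eqP.
Qed.

End Poly.

Section Charts.
Variable R : realType.
Local Notation C := R[i].

Definition pslice (u : C) (p : {poly {poly C}}) : {poly C} :=
  map_poly (horner_eval u) p.

Lemma pslice_horner (p : {poly {poly C}}) u y : (pslice u p).[y] = eval2 p u y.
Proof.
rewrite /pslice /eval2 -[y in LHS](hornerC y u).
rewrite -[y%:P.[u]]/(horner_eval u y%:P).
by rewrite horner_map.
Qed.

Lemma pslice_horner0 (p : {poly {poly C}}) u : (pslice u p).[0] = p.[0].[u].
Proof. by rewrite pslice_horner. Qed.

(** Freezing a generic [u], at which the denominators and the numerator of [R2] do not vanish on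
    [y = 0], leaves quotients of polynomials in [v ^+ 2]. *)
Lemma quadratic_regularisable_slice {D F phi} {t : C} :
  quadratic_regularisable D F phi -> D t ->
  exists (u : C) (n1 d1 n2 d2 : {poly C}),
    [/\ u != 0, d1.[0] != 0, d2.[0] != 0, n2.[0] != 0 & forall v : C, v != 0 ->
        (phi t (u, v)).1 != 0 -> (phi t (u, v)).2 != 0 ->
        d1.[v ^+ 2] != 0 -> d2.[v ^+ 2] != 0 ->
        chart_velocity F phi t (u, v)
          (n1.[v ^+ 2] / d1.[v ^+ 2], v^-1 * (n2.[v ^+ 2] / d2.[v ^+ 2]))].
Proof.
move=> [R1 [R2 reg]] /reg[reg1 reg2 nz vel].
pose Z := (R1 t).2.[0] * (R2 t).2.[0] * (R2 t).1.[0].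
(* The factor ['X] forces [u != 0], which the charts near [q = 0] need. *)
have [u u0] : exists u, (Z * 'X).[u] != 0.
  apply: contrapT => Zu; have : Z * 'X = 0.
    apply: (@poly_eq0_cofinite _ _ 1); rewrite ?oner_neq0// => v _.
    by apply: contrapT => /eqP Zv; apply: Zu; exists v.
  apply/eqP; rewrite mulf_neq0 ?polyX_eq0// !mulf_neq0//.
move: u0; rewrite /Z !hornerM hornerX !mulf_eq0 !negb_or.
move=> /andP[/andP[/andP[? ?] ?] ?].
exists u, (pslice u (R1 t).1), (pslice u (R1 t).2).
exists (pslice u (R2 t).1), (pslice u (R2 t).2).
by split; rewrite ?pslice_horner0// => v; rewrite !pslice_horner; exact: vel.
Qed.

Lemma laurent_rhsE (a : int -> C -> C) t q :
  laurent_rhs a t q = 3 * q ^+ 5 / 64 +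
   (a (- 3) t * q ^- 3 + a (- 2) t * q ^- 2 + a (- 1) t * q^-1 + a 0 t
    + a 1 t * q + a 2 t * q ^+ 2 + a 3 t * q ^+ 3 + a 4 t * q ^+ 4).
Proof.
rewrite /laurent_rhs !big_ord_recl big_ord0 /= !addrA addr0.
rewrite /exprz /=.
by rewrite mulr1.
Qed.

(** * Velocities in blow-up charts *)

Lemma is_derive_unique (f : C^o -> C^o) (t d d' : C^o) :
  is_derive t (1 : C^o) f d -> is_derive t (1 : C^o) f d' -> d = d'.
Proof. by move=> [_ <-] [_ <-]. Qed.

Lemma is_derive_eq_on {D : set C^o} {f g : C^o -> C^o} {t d : C^o} :
  open D -> D t -> (forall s, D s -> f s = g s) ->
  is_derive t (1 : C^o) f d -> is_derive t (1 : C^o) g d.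
Proof.
move=> oD Dt fg; apply: near_eq_is_derive.
by have : nbhs t D by [exact: open_nbhs_nbhs]; apply: filterS => s /fg.
Qed.

Lemma is_derive_eq_fun (f g : C^o -> C^o) (t d : C^o) :
  f =1 g -> is_derive t (1 : C^o) f d -> is_derive t (1 : C^o) g d.
Proof. by move=> /funext ->. Qed.

(** The charts produce [q] and [p] as inverses. Derivability of [X] is part of the conclusion and
    comes from inverting [(X s)^-1] again. *)
Lemma is_derive_inv (X : C^o -> C^o) (t d : C^o) : X t != 0 ->
  is_derive t (1 : C^o) (fun s => (X s)^-1) d ->
  is_derive t (1 : C^o) X (- (X t) ^+ 2 * d).
Proof.
move=> X0 [dX dE]; have Xi0 : (X t)^-1 != 0 by rewrite invr_eq0.
have XE : (fun s => ((X s)^-1)^-1) = X by apply/funext => s; rewrite invrK.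
have := @derivableV _ (C^o) (fun s => (X s)^-1) t 1 Xi0 dX; rewrite XE => dX'.
apply: DeriveDef; first exact: dX'.
have := @deriveV _ (C^o) (fun s => (X s)^-1) t 1 Xi0 dX; rewrite XE dE => ->.
by rewrite [_ *: _]/( _ * _) exprVn invrK.
Qed.

(** The shape [x + a b] is the first coordinate of a blow-up, so iteration differentiates a whole
    tower from the inside out. *)
Lemma is_derive_blow {x a b : C^o -> C^o} {t dx da db : C^o} :
  is_derive t (1 : C^o) x dx -> is_derive t (1 : C^o) a da ->
  is_derive t (1 : C^o) b db ->
  is_derive t (1 : C^o) (fun s => x s + a s * b s) (dx + (a t * db + b t * da)).
Proof. by move=> *; exact: (is_deriveD _ (is_deriveM _ _)). Qed.

Lemma is_derive_const (t x : C^o) :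
  is_derive t (1 : C^o) (fun=> x : C^o) 0.
Proof. exact: is_derive_cst. Qed.

Lemma is_derive_path (t z w : C^o) :
  is_derive t (1 : C^o) (fun s => z + (s - t) * w) w.
Proof.
have -> : (fun s : C^o => z + (s - t) * w : C^o) =
    (cst (z - t * w) : C^o -> C^o) + w \*: (id : C^o -> C^o).
  apply/funext => s; change (z + (s - t) * w = z - t * w + w * s :> C); ring.
have := is_deriveD (is_derive_cst (z - t * w : C^o) t 1)
  (@is_deriveZ _ (C^o) (C^o) id w t 1 1 (is_derive_id _ _)).
by rewrite add0r [_ *: 1]mulr1.
Qed.

Lemma tower_snd (xs : seq C) w : (tower xs w).2 = w.2.
Proof. by elim: xs => //= x xs; rewrite add0r. Qed.

Lemma tower_cons (x : C) xs w :
  tower (x :: xs) w = (x + (tower xs w).1 * w.2, w.2).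
Proof.
by rewrite -[LHS]/(x + (tower xs w).1 * (tower xs w).2, 0 + (tower xs w).2)
  tower_snd add0r.
Qed.

(** Here [q = 1 / v] and [p = 1 / (v^3 U)]. The first conclusion is [q' = p]; the second is
    [p' = f], read as [(v^3 U)' = - (v^3 U)^2 f]. *)
Lemma chart_infty_velocity (f : C -> C -> C) (e u v u' v' : C)
    (k1 k2 k3 k4 k5 : C -> C) (t d1 d2 d3 d4 d5 : C) :
  let phi s w := from_QP (blow_UV (0, 0)
    (tower [:: 0; 0; e; k1 s; k2 s; k3 s; k4 s; k5 s] w)) in
  let U := e + v * (k1 t + v * (k2 t + v * (k3 t + v * (k4 t
             + v * (k5 t + v * u))))) in
  is_derive (t : C^o) (1 : C^o) (k1 : C^o -> C^o) d1 ->
  is_derive (t : C^o) (1 : C^o) (k2 : C^o -> C^o) d2 ->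
  is_derive (t : C^o) (1 : C^o) (k3 : C^o -> C^o) d3 ->
  is_derive (t : C^o) (1 : C^o) (k4 : C^o -> C^o) d4 ->
  is_derive (t : C^o) (1 : C^o) (k5 : C^o -> C^o) d5 ->
  v != 0 -> U != 0 ->
  chart_velocity (second_order f) phi t (u, v) (u', v') ->
  v' = - (v * U)^-1 /\
  3 * v ^+ 2 * v' * U + v ^+ 3 *
    (v * (d1 + v * (d2 + v * (d3 + v * (d4 + v * (d5 + v * u')))))
     + v' * (k1 t + v * (2 * k2 t + v * (3 * k3 t + v * (4 * k4 t
             + v * (5 * k5 t + v * (6 * u)))))))
  = - (v ^+ 3 * U) ^+ 2 * f t v^-1.
Proof.
move=> phi U D1 D2 D3 D4 D5 v0 U0.
have phi1 s w : (phi s w).1 = w.2^-1.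
  by rewrite /phi !tower_cons /from_QP /blow_UV /= !add0r.
have phi2 s w : (phi s w).2 = (((e + (k1 s + (k2 s + (k3 s + (k4 s +
    (k5 s + w.1 * w.2) * w.2) * w.2) * w.2) * w.2) * w.2) * w.2 * w.2) * w.2)^-1.
  by rewrite /phi !tower_cons /from_QP /blow_UV /= !add0r.
clearbody phi.
pose V (s : C^o) : C^o := v + (s - t) * v'.
pose X (s : C^o) : C^o := ((e + (k1 s + (k2 s + (k3 s + (k4 s +
    (k5 s + (u + (s - t) * u') * V s) * V s) * V s) * V s) * V s) * V s)
     * V s * V s) * V s.
have Vt : V t = v by rewrite /V subrr mul0r addr0.
have Xt : X t = v ^+ 3 * U by rewrite /X Vt subrr /U; ring.
have X0 : X t != 0 by rewrite Xt mulf_neq0// expf_neq0.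
have qE : (fun s : C^o => (phi s (u + (s - t) * u', v + (s - t) * v')).1)
    = (fun s => (V s)^-1) by apply/funext => s; rewrite phi1.
have pE : (fun s : C^o => (phi s (u + (s - t) * u', v + (s - t) * v')).2)
    = (fun s => (X s)^-1) by apply/funext => s; rewrite phi2.
have pX : (phi t (u, v)).2 = (v ^+ 3 * U)^-1.
  by rewrite phi2 -Xt /X Vt subrr mul0r addr0.
rewrite /chart_velocity /= phi1 pX qE pE => -[].
move=> /is_derive_inv; rewrite Vt => /(_ v0) /is_derive_unique.
move=> /(_ _ (is_derive_path t v v')) vE.
have {vE} vE : v' = - (v * U)^-1.
  by rewrite -vE; field; rewrite v0 U0.
move=> /(is_derive_inv X0) /is_derive_unique dX; split => //.
have dV := is_derive_path t v v'.
have dU := is_derive_path t u u'.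
have D := is_derive_blow D1 (is_derive_blow D2 (is_derive_blow D3
  (is_derive_blow D4 (is_derive_blow D5 dU dV) dV) dV) dV) dV.
have {}D := is_derive_blow (is_derive_const t e) D dV.
(* Of the three zero constants, two are centres of the tower and the last is the centre in
   [blow_UV]. *)
have {}D := is_derive_blow (is_derive_const t 0) D dV.
have {}D := is_derive_blow (is_derive_const t 0) D dV.
have {}D := is_derive_blow (is_derive_const t 0) D dV.
rewrite -Xt (dX _ (is_derive_eq_fun _ D)); last first.
  by move=> s; rewrite /X /V /=; ring.
by rewrite /= subrr !mul0r !addr0 /U; ring.
Qed.

(** Here [p = 1 / v] and [q = v (x + v (y + v u))], so it is [p' = f] that yields [v'], while
    [q' = p] constrains [u']. *)
Lemma chart_zero_velocity (f : C -> C -> C) (u v u' v' : C)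
    (x y : C -> C) (t dx dy : C) :
  let phi s w := from_qP (tower [:: 0; x s; y s] w) in
  is_derive (t : C^o) (1 : C^o) (x : C^o -> C^o) dx ->
  is_derive (t : C^o) (1 : C^o) (y : C^o -> C^o) dy ->
  v != 0 ->
  chart_velocity (second_order f) phi t (u, v) (u', v') ->
  v' = - v ^+ 2 * f t (v * (x t + v * (y t + v * u))) /\
  v' * (x t + v * (2 * y t + v * (3 * u))) + v * (dx + v * (dy + v * u'))
  = v^-1.
Proof.
move=> phi Dx Dy v0.
have phi1 s w : (phi s w).1 = (x s + (y s + w.1 * w.2) * w.2) * w.2.
  by rewrite /phi !tower_cons /from_qP /= add0r.
have phi2 s w : (phi s w).2 = w.2^-1.
  by rewrite /phi !tower_cons /from_qP /=.
clearbody phi.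
pose V (s : C^o) : C^o := v + (s - t) * v'.
pose X (s : C^o) : C^o := (x s + (y s + (u + (s - t) * u') * V s) * V s) * V s.
have Vt : V t = v by rewrite /V subrr mul0r addr0.
have pE : (fun s : C^o => (phi s (u + (s - t) * u', v + (s - t) * v')).2)
    = (fun s => (V s)^-1) by apply/funext => s; rewrite phi2.
have qE : (fun s : C^o => (phi s (u + (s - t) * u', v + (s - t) * v')).1)
    = X by apply/funext => s; rewrite phi1.
have qt : (phi t (u, v)).1 = v * (x t + v * (y t + v * u)).
  by rewrite phi1 /=; ring.
rewrite /chart_velocity /= phi2 qt qE pE => -[/is_derive_unique dX].
move=> /is_derive_inv; rewrite Vt => /(_ v0) /is_derive_unique.
move=> /(_ _ (is_derive_path t v v')) vE; split; first by rewrite -vE.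
have dV := is_derive_path t v v'.
have dU := is_derive_path t u u'.
have D := is_derive_blow Dx (is_derive_blow Dy dU dV) dV.
have {}D := is_derive_blow (is_derive_const t 0) D dV.
rewrite /= in dX; rewrite (dX _ (is_derive_eq_fun _ D)); last first.
  by move=> s; rewrite /X /V /=; ring.
by rewrite /= subrr !mul0r !addr0; ring.
Qed.

End Charts.

(** * Conditions at a fixed time *)

Section LowCoefficients.
Variable K : comNzRingType.
Implicit Types p q : {poly K}.

(** Orders 0 to 3 suffice: the unknown numerator of [R1] enters with a factor ['X^4], in the
    variable [v^2] at infinity and in [v] near [q = 0]. *)
Lemma coefM_low p q :
  ((p * q)`_0 = p`_0 * q`_0) *
  ((p * q)`_1 = p`_0 * q`_1 + p`_1 * q`_0) *
  ((p * q)`_2 = p`_0 * q`_2 + p`_1 * q`_1 + p`_2 * q`_0) *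
  ((p * q)`_3 = p`_0 * q`_3 + p`_1 * q`_2 + p`_2 * q`_1 + p`_3 * q`_0).
Proof. by rewrite !coefM !big_ord_recl !big_ord0 /= !addr0 !addrA. Qed.

End LowCoefficients.

Section Conditions.
Variable R : realType.
Local Notation C := R[i].

(** * Charts over [q = p = oo] *)

Section Infinity.
Variables (D : set C^o) (f : C -> C -> C) (e : C) (k1 k2 k3 k4 k5 : C -> C).
Variables (t d1 d2 d3 d4 d5 : C).
Hypothesis e0 : e != 0.
Hypothesis Dt : D t.
Hypothesis D1 : is_derive (t : C^o) (1 : C^o) (k1 : C^o -> C^o) d1.
Hypothesis D2 : is_derive (t : C^o) (1 : C^o) (k2 : C^o -> C^o) d2.
Hypothesis D3 : is_derive (t : C^o) (1 : C^o) (k3 : C^o -> C^o) d3.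
Hypothesis D4 : is_derive (t : C^o) (1 : C^o) (k4 : C^o -> C^o) d4.
Hypothesis D5 : is_derive (t : C^o) (1 : C^o) (k5 : C^o -> C^o) d5.
Hypothesis reg : quadratic_regularisable D (second_order f)
  (fun s w => from_QP (blow_UV (0, 0)
    (tower [:: 0; 0; e; k1 s; k2 s; k3 s; k4 s; k5 s] w))).

(* The coordinate [u_8] in terms of those of the last chart. *)
Let U u v := e + v * (k1 t + v * (k2 t + v * (k3 t + v * (k4 t
               + v * (k5 t + v * u))))).

(** Comparing [v' = R2 / v] with [v' = - 1 / (v U)] gives [R2 U = - 1], the first identity once
    denominators are cleared. All excluded values of [v] are collected among the roots of [Z]. *)
Lemma chart_infty_slice :
  exists (u : C) (m1 n1 m2 n2 Z : {poly C}),
    [/\ n1.[0] != 0, m2.[0] != 0, Z != 0 & forall v, Z.[v] != 0 ->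
      [/\ v != 0, U u v != 0, n1.[v ^+ 2] != 0 &
        m2.[v ^+ 2] * U u v = - n2.[v ^+ 2] /\
        3 * v ^+ 2 * (- (v * U u v)^-1) * U u v + v ^+ 3 *
        (v * (d1 + v * (d2 + v * (d3 + v * (d4 + v * (d5
            + v * (m1.[v ^+ 2] / n1.[v ^+ 2]))))))
         + (- (v * U u v)^-1) * (k1 t + v * (2 * k2 t + v * (3 * k3 t
             + v * (4 * k4 t + v * (5 * k5 t + v * (6 * u)))))))
        = - (v ^+ 3 * U u v) ^+ 2 * f t v^-1]].
Proof.
have [u [m1 [n1 [m2 [n2 [u0 n10 n20 m20 vel]]]]]] :=
  quadratic_regularisable_slice reg Dt.
pose P := Poly [:: e; k1 t; k2 t; k3 t; k4 t; k5 t; u].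
have PE v : P.[v] = U u v by rewrite /P horner_Poly /U /=; ring.
have P0 : P.[0] != 0 by rewrite PE /U mul0r addr0.
exists u, m1, n1, m2, n2, ('X * (n1 \Po 'X^2) * (n2 \Po 'X^2) * P); split => //.
  have nz (p : {poly C}) : p.[0] != 0 -> p != 0.
    by apply: contra_neq => ->; rewrite horner0.
  rewrite !mulf_neq0 ?polyX_eq0 ?nz //.
  - by rewrite horner_comp !hornerE expr0n.
  - by rewrite horner_comp !hornerE expr0n.
move=> v; rewrite !hornerM !horner_comp !hornerXn hornerX PE !mulf_eq0 !negb_or.
move=> /andP[/andP[/andP[v0 n1v] n2v] Uv].
have q0 : v^-1 != 0 by rewrite invr_eq0.
have p0 : (v ^+ 3 * U u v)^-1 != 0 by rewrite invr_eq0 mulf_neq0// expf_neq0.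
have [||vE pE] := chart_infty_velocity D1 D2 D3 D4 D5 v0 Uv
  (vel v v0 _ _ n1v n2v).
- by rewrite !tower_cons /from_QP /blow_UV /= !add0r.
- rewrite !tower_cons /from_QP /blow_UV /= !add0r.
  by rewrite [X in X^-1](_ : _ = v ^+ 3 * U u v)// /U; ring.
rewrite vE in pE; have {}vE : m2.[v ^+ 2] / n2.[v ^+ 2] = - (U u v)^-1.
  by apply: (mulfI q0); rewrite vE invfM mulrN.
split => //; split; last exact: pE.
by move/(canRL (divfK n2v)) : vE => ->; field; rewrite Uv.
Qed.

(** The odd part of [m2 U = - n2] is [m2] times the odd part of [U]. *)
Lemma chart_infty_centres : [/\ k1 t = 0, k3 t = 0 & k5 t = 0].
Proof.
have [u [m1 [n1 [m2 [n2 [Z [n10 m20 Z0 H]]]]]]] := chart_infty_slice.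
have [_ B0] : m2 * Poly [:: e; k2 t; k4 t; u] + n2 = 0 /\
    m2 * Poly [:: k1 t; k3 t; k5 t] = 0.
  apply: (poly_even_odd_eq0 Z0) => v /H[_ _ _ [E _]].
  rewrite hornerD !hornerM !horner_Poly /=; apply/eqP.
  rewrite addrAC addr_eq0 -E.
  by apply/eqP; rewrite /U; ring.
have P0 : Poly [:: k1 t; k3 t; k5 t] = 0.
  apply/eqP; move/eqP: B0; rewrite mulf_eq0 => /orP[/eqP m2_0|//].
  by move: m20; rewrite m2_0 horner0 eqxx.
have c i : [:: k1 t; k3 t; k5 t]`_i = 0 by rewrite -coef_Poly P0 coef0.
by split; [exact: c 0%N|exact: c 1%N|exact: c 2%N].
Qed.

Variables b3 b2 b1 a0 a1 a2 a3 a4 : C.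
Hypothesis fE : forall q, f t q = 3 * q ^+ 5 / 64 +
  (b3 * q ^- 3 + b2 * q ^- 2 + b1 * q^-1 + a0
   + a1 * q + a2 * q ^+ 2 + a3 * q ^+ 3 + a4 * q ^+ 4).
Hypothesis odd_centres : [/\ k1 t = 0, k3 t = 0 & k5 t = 0].
Hypothesis odd_velocities : [/\ d1 = 0, d3 = 0 & d5 = 0].

Hypothesis e8 : e = 8 \/ e = - 8.

(** The odd velocities are assumed to vanish separately, since a zero of a centre at the single time
    [t] says nothing about its derivative. *)
Lemma chart_infty_equations :
  [/\ b2 = 0, a0 = 0, a2 = 0 & a4 = 0] /\
  [/\ k2 t = - (e * (16 * a3)),
      2 * k4 t = e * (3 * (16 * a3) ^+ 2 - 64 * a1 - d2)
    & d4 = - 64 * b1 - 2 * (16 * a3) * d2].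
Proof.
have [u [m1 [n1 [m2 [n2 [Z [n10 m20 Z0 H]]]]]]] := chart_infty_slice.
have [k1t k3t k5t] := odd_centres; have [d10 d30 d50] := odd_velocities.
(* With [h = v^2], the equation for [u'] multiplied by [n1 U / v] has even part
   [n1 G + h^4 m1 E] and odd part [v n1 E^3 B], evaluated at [h]. *)
pose E := Poly [:: e; k2 t; k4 t; u].
pose A := Poly [:: 3 / 64; a3; a1; b1; b3].
pose G := E * E * E * A + E * Poly [:: 0; 0; d2; d4]
  - Poly [:: 3 * e; 5 * k2 t; 7 * k4 t; 9 * u].
pose B := Poly [:: a4; a2; a0; b2].
have [A0 B0] : n1 * G + 'X^4 * (m1 * E) = 0 /\ n1 * (E * E * E * B) = 0.
  apply: (poly_even_odd_eq0 Z0) => v /H[v0 Uv n1v [_]].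
  have UE : U u v = E.[v ^+ 2].
    by rewrite /U k1t k3t k5t /E horner_Poly /=; ring.
  rewrite UE in Uv *; move: Uv; rewrite fE k1t k3t k5t d10 d30 d50.
  rewrite !(hornerD, hornerM, hornerN, hornerX) !horner_Poly /=.
  move: (m1.[_]) (n1.[_]) n1v => m n n_neq0.
  rewrite mul0r add0r => Uv /eqP; rewrite -subr_eq0 => /eqP eqn.
  (* The target is the equation [eqn] times the displayed factor, here [n1 U / v]. The same device
     recurs below with other factors. *)
  rewrite -[RHS](mul0r
    (n * (((u * v ^+ 2 + k4 t) * v ^+ 2 + k2 t) * v ^+ 2 + e) / v)).
  by rewrite -[X in _ = X * _]eqn; field; rewrite v0 Uv n_neq0.

have BP : B = 0.
  apply/eqP; move/eqP: B0; rewrite !mulf_eq0.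
  have -> : (n1 == 0) = false.
    by apply: contra_neqF n10 => /eqP ->; rewrite horner0.
  have -> : (E == 0) = false.
    apply: contra_neqF e0 => /eqP E0.
    by rewrite -[e]/([:: e; k2 t; k4 t; u]`_0) -coef_Poly -/E E0 coef0.
  by [].
have c i : [:: a4; a2; a0; b2]`_i = 0.
  by rewrite -coef_Poly -/B BP coef0.
split; first by split; [exact: c 3%N|exact: c 2%N|exact: c 1%N|exact: c 0%N].
have g i : (i < 4)%N -> G`_i = 0.
  apply: (coefM_Xn_eq0 (d := n1) (H := - (m1 * E))).
    by rewrite -horner_coef0.
  by apply/eqP; rewrite mulrN -addr_eq0 A0.
(* Order 0 holds as [e^2 = 64]. At orders 1, 2, 3 the newest unknown [k2], [k4], [u] has coefficient
   [9 - 5], [9 - 7], [9 - 9]: two orders are solved, and the resonance at the third leaves the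
   condition on [d4]. *)
have gE := (g 0%N isT, g 1%N isT, g 2%N isT, g 3%N isT).
move: gE; rewrite /G /A /E !(coefD, coefN, coefM_low, coef_Poly) /=.
move=> [[[g0 g1] g2] g3].
have k2E : k2 t = - (e * (16 * a3)).
  apply: subr0_eq; rewrite -[RHS](mul0r (4^-1)) -[X in _ = X * _]g1.
  by case: e8 => ->; field.
have k4E : 2 * k4 t = e * (3 * (16 * a3) ^+ 2 - 64 * a1 - d2).
  apply: subr0_eq; rewrite -[RHS]g2 k2E.
  by case: e8 => ->; field.
split=> //; have {}k4E : k4 t = e * (3 * (16 * a3) ^+ 2 - 64 * a1 - d2) / 2.
  by rewrite -k4E; field.
apply: subr0_eq; rewrite -[RHS](mul0r (e / 64)) -[X in _ = X * _]g3 k2E k4E.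
by case: e8 => ->; field.
Qed.

End Infinity.

(** * Charts over [q = 0], [p = oo] *)

Section Zero.
Variables (D : set C^o) (f : C -> C -> C) (x y : C -> C) (t dx dy : C).
Variables b3 b1 a1 a3 : C.
Hypothesis Dt : D t.
Hypothesis Dx : is_derive (t : C^o) (1 : C^o) (x : C^o -> C^o) dx.
Hypothesis Dy : is_derive (t : C^o) (1 : C^o) (y : C^o -> C^o) dy.
Hypothesis reg : quadratic_regularisable D (second_order f)
  (fun s w => from_qP (tower [:: 0; x s; y s] w)).
Hypothesis fE : forall q, f t q = 3 * q ^+ 5 / 64 +
  (b3 * q ^- 3 + b1 * q^-1 + a1 * q + a3 * q ^+ 3).

(** Both equations are expanded in [v]: order 0 gives [x t != 0] and [b3], order 1 gives [y t = 0],
    and order 2 gives [dx]. *)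
Lemma chart_zero_equations : [/\ x t != 0, b3 = - x t ^+ 2 & dx = b1].
Proof.
have [u [m1 [n1 [m2 [n2 [u0 n10 n20 m20 vel]]]]]] :=
  quadratic_regularisable_slice reg Dt.
pose W := Poly [:: x t; y t; u].
pose sq (p : {poly C}) := p \Po 'X^2.
have sqE p v : (sq p).[v] = p.[v ^+ 2] by rewrite horner_comp hornerXn.
have WE v : W.[v] = x t + v * (y t + v * u) by rewrite horner_Poly /=; ring.
(* Nothing is known of [x t] yet, so the leading coefficient [u] is used. *)
have W0 : W != 0.
  apply: contra_neq u0 => W0.
  by rewrite -[u]/([:: x t; y t; u]`_2) -coef_Poly -/W W0 coef0.
pose Z := 'X * sq n1 * sq n2 * W.
have Z0 : Z != 0.
  have nz (p : {poly C}) : p.[0] != 0 -> p != 0.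
    by apply: contra_neq => ->; rewrite horner0.
  by rewrite !mulf_neq0 ?polyX_eq0// nz// sqE expr0n.
have vel' v : Z.[v] != 0 -> [/\ v != 0, n1.[v ^+ 2] != 0, n2.[v ^+ 2] != 0,
    W.[v] != 0 &
    v^-1 * (m2.[v ^+ 2] / n2.[v ^+ 2]) = - v ^+ 2 * f t (v * W.[v]) /\
    v^-1 * (m2.[v ^+ 2] / n2.[v ^+ 2]) * (x t + v * (2 * y t + v * (3 * u)))
      + v * (dx + v * (dy + v * (m1.[v ^+ 2] / n1.[v ^+ 2]))) = v^-1].
  rewrite /Z !hornerM !sqE hornerX !mulf_eq0 !negb_or.
  move=> /andP[/andP[/andP[v0 n1v] n2v] Wv]; split=> //.
  rewrite WE; apply: (chart_zero_velocity Dx Dy v0); apply: vel => //.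
    rewrite !tower_cons /from_qP /= !add0r.
    rewrite [X in X != 0](_ : _ = v * W.[v]) ?mulf_neq0//.
    by rewrite WE; ring.
  by rewrite !tower_cons /from_qP /= invr_eq0.
(* The equation for [q'] is [sq n1 * Q + v^4 (sq m1) (sq n2) = 0]; the one for
   [p'] is [S = 0]. *)
pose Q := sq m2 * Poly [:: x t; 2 * y t; 3 * u]
  + sq n2 * Poly [:: -1; 0; dx; dy].
have Q0 : sq n1 * Q = 'X^4 * - (sq m1 * sq n2).
  apply/eqP; rewrite mulrN -addr_eq0; apply/eqP/(poly_eq0_cofinite Z0) => v.
  move=> /vel'[v0 n1v n2v _ [_]].
  rewrite !(hornerD, hornerM, sqE, hornerX) !horner_Poly /=.
  move: (m1.[_]) (n1.[_]) (m2.[_]) (n2.[_]) n1v n2v => m n m' n' n0 n0'.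
  move=> /eqP; rewrite -subr_eq0 => /eqP eqn.
  rewrite -[RHS](mul0r (n * n' * v)) -[X in _ = X * _]eqn.
  by field; rewrite v0 n0 n0'.
pose T := b1%:P + 'X^2 * (W * W * (a1%:P + 'X^2 * (W * W)
  * (a3%:P + 'X^2 * (W * W) * (3 / 64)%:P))).
pose S := sq m2 * (W * W * W) + sq n2 * (b3%:P + 'X^2 * (W * W * T)).
have S0 : S = 0.
  apply/(poly_eq0_cofinite Z0) => v /vel'[v0 n1v n2v Wv [+ _]].
  rewrite fE /S /T !(hornerD, hornerM, sqE, hornerX, hornerC) /=.
  move: (m2.[_]) (n2.[_]) (W.[_]) n2v Wv => m n w n0 w0.
  move=> /eqP; rewrite -subr_eq0 => /eqP eqn.
  rewrite -[RHS](mul0r (n * v * w ^+ 3)) -[X in _ = X * _]eqn.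
  by field; rewrite v0 n0 w0.
have sqc (p : {poly C}) : ((sq p)`_0 = p`_0) * ((sq p)`_1 = 0)
    * ((sq p)`_2 = p`_1) * ((sq p)`_3 = 0).
  by rewrite !coef_comp_poly_Xn.
clearbody sq.
have q i : (i < 4)%N -> Q`_i = 0.
  by apply: (coefM_Xn_eq0 _ Q0); rewrite sqc -horner_coef0.
have s i : S`_i = 0 by rewrite S0 coef0.
have := (q 0%N isT, q 2%N isT, s 0%N, s 1%N, s 2%N).
have T0 : T`_0 = b1 by rewrite coefD coefC coefXnM addr0.
rewrite /Q /S !coefD !coefM_low !coefD !coefXnM !coefC subnn.
rewrite !coefM_low T0 /W !coef_Poly !sqc /=.
rewrite -!horner_coef0.
move: (m2.[0]) (n2.[0]) (m2`_1) (n2`_1) m20 n20 => m n m' n' m_neq0 n_neq0.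
move=> [[[[q0 q2] s0] s1] s2].
have nE : n = m * x t by apply/esym/subr0_eq; rewrite -[RHS]q0; ring.
have x0 : x t != 0 by move: n_neq0; rewrite nE mulf_eq0 negb_or => /andP[].
have bE : b3 = - x t ^+ 2.
  apply: subr0_eq; rewrite -[RHS](mul0r (m * x t)^-1) -[X in _ = X * _]s0 nE.
  by field; rewrite m_neq0 x0.
have yE : y t = 0.
  rewrite -[RHS](mul0r (3 * m * x t ^+ 2)^-1) -[X in _ = X * _]s1.
  by field; rewrite m_neq0 x0.
split => //; apply: subr0_eq.
(* This combination of the order-2 equations eliminates [u] and the unknowns [m'] and [n'], leaving
   [dx - b1]. *)
have := congr2 (fun a b : C => (a - b / x t ^+ 2) / n) q2 s2.
rewrite yE bE nE !mul0r subrr mul0r => <-.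
by field; rewrite m_neq0 x0.
Qed.

End Zero.
End Conditions.

(** * Integration of the conditions *)

(** The scaling [q = k x], [t = r s - mu / lam] preserves the [q^5] term iff [r^2 k^4 = 1] and turns
    the [q^3] term into [s / 2] if also [r k^2 lam = 1]; then [p = (k / r) y] preserves [q' = p]. *)
Lemma takasaki_rescaling (R : realType) (D : set (R[i])^o) (F : system R)
    (lam mu alpha beta : R[i]) :
  lam != 0 ->
  (forall t q p : R[i], D t -> q != 0 ->
    F t (q, p) =
      second_order (takasaki_rhs alpha beta) (lam * t + mu) (q, p)) ->
  exists alpha' beta' : R[i],
    affinely_equivalent D F (second_order (takasaki_rhs alpha' beta')).
Proof.
move=> lam0 FE.
pose r := sqrtc lam^-1; pose k := sqrtc r^-1.
have r2 : r ^+ 2 = lam^-1 by exact: sqr_sqrtc.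
have k2 : k ^+ 2 = r^-1 by exact: sqr_sqrtc.
have r0 : r != 0.
  by apply: contra_neq lam0 => r0; apply: invr_inj; rewrite -r2 r0 expr0n invr0.
have k0 : k != 0.
  by apply: contra_neq r0 => k0; apply: invr_inj; rewrite -k2 k0 expr0n invr0.
exists (r ^+ 2 * alpha), (r ^+ 4 * beta), r, (- mu / lam), k, (k / r).
split => //; first by rewrite mulf_neq0// invr_eq0.
move=> s x y Ds x0; rewrite FE// ?mulf_neq0// /second_order /takasaki_rhs /=.
(* Writing [r] and [lam] as powers of [k] leaves identities without square roots. *)
have rE : r = k ^- 2 by rewrite k2 invrK.
have lE : lam = k ^+ 4.
  by rewrite -[lam]invrK -r2 rE; field.
rewrite lE rE; congr pair; first by field.
by field; rewrite k0 x0.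
Qed.

Section HolomorphicCentres.
Variable R : realType.
Local Notation C := R[i].
Variables (D : set C^o) (D_open : open D).
Local Notation "f ^'" := (fun t : C => 'D_(1 : C^o) (f : C^o -> C^o) (t : C^o)).

Lemma holomorphic_is_derive (f : C -> C) (t : C) :
  holomorphic_on D f -> D t ->
  is_derive (t : C^o) (1 : C^o) (f : C^o -> C^o) (f^' t).
Proof. by move=> hf Dt; exact/derivableP/hf. Qed.

Lemma derive_on_eq (f g : C -> C) (t d : C) : D t ->
  (forall s, D s -> f s = g s) ->
  is_derive (t : C^o) (1 : C^o) (f : C^o -> C^o) d -> g^' t = d.
Proof.
move=> Dt fg Df.
by have [_] := is_derive_eq_on (g := g : C^o -> C^o) D_open Dt fg Df.
Qed.

(** The odd centres vanish on all of the open set [D], so their derivatives vanish too; this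
    supplies the odd velocities. *)
Lemma chart_infty_holomorphic (a : int -> C -> C) (e : C)
    (k1 k2 k3 k4 k5 : C -> C) :
  e = 8 \/ e = - 8 ->
  holomorphic_on D k1 -> holomorphic_on D k2 -> holomorphic_on D k3 ->
  holomorphic_on D k4 -> holomorphic_on D k5 ->
  quadratic_regularisable D (second_order (laurent_rhs a))
    (fun s w => from_QP (blow_UV (0, 0)
      (tower [:: 0; 0; e; k1 s; k2 s; k3 s; k4 s; k5 s] w))) ->
  forall t, D t ->
  [/\ a (- 2) t = 0, a 0 t = 0, a 2 t = 0 & a 4 t = 0] /\
  [/\ k2 t = - (e * (16 * a 3 t)),
      2 * k4 t = e * (3 * (16 * a 3 t) ^+ 2 - 64 * a 1 t - k2^' t)
    & k4^' t = - 64 * a (- 1) t - 2 * (16 * a 3 t) * k2^' t].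
Proof.
move=> e8 h1 h2 h3 h4 h5 reg.
have e0 : e != 0 by case: e8 => ->; rewrite ?oppr_eq0 pnatr_eq0.
pose der := holomorphic_is_derive.
have odd0 t (Dt : D t) := chart_infty_centres e0 Dt (der _ _ h1 Dt)
  (der _ _ h2 Dt) (der _ _ h3 Dt) (der _ _ h4 Dt) (der _ _ h5 Dt) reg.
move=> t Dt; apply: (chart_infty_equations e0 Dt (der _ _ h1 Dt)
  (der _ _ h2 Dt) (der _ _ h3 Dt) (der _ _ h4 Dt) (der _ _ h5 Dt) reg _
  (odd0 t Dt) _ e8).
  by move=> q; exact: laurent_rhsE.
have zero k : (forall s, D s -> k s = 0) -> k^' t = 0.
  by move=> k0; apply: (derive_on_eq Dt (f := fun=> 0)) => s /k0 ->.
by split; apply: zero => s /odd0[].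
Qed.

End HolomorphicCentres.

(** For [lam = 0] the system is a Takasaki system frozen at time [mu], and [lam * t + mu] is no
    invertible change of time; hence the two-part conclusion. *)
Theorem theorem16 (R : realType) (D : set (R[i])^o) (a : int -> R[i] -> R[i])
    (D_open : open D) (D_connected : connected D)
    (a_holo : forall k : int, - 3 <= k <= 4 -> holomorphic_on D (a k))
    (a_neq0 : exists2 t : R[i], D t & a (- 3) t != 0)
    (a_reg : quadratic_regularisable_on_Takasaki_configuration D
               (second_order (laurent_rhs a))) :
  exists lam mu alpha beta : R[i],
    (forall t q p : R[i], D t -> q != 0 ->
       second_order (laurent_rhs a) t (q, p) =
       second_order (takasaki_rhs alpha beta) (lam * t + mu) (q, p)) /\
    (lam != 0 -> exists alpha' beta' : R[i],
       affinely_equivalent D (second_order (laurent_rhs a))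
         (second_order (takasaki_rhs alpha' beta'))).
Proof.
have [c [c_holo c24 [reg3 reg5 reg14 reg20]]] := a_reg.
have [t0 Dt0 _] := a_neq0.
pose d i (t : R[i]) : R[i] :=
  'D_(1 : (R[i])^o) (c i : (R[i])^o -> (R[i])^o) (t : (R[i])^o).
have Dc i t (Dt : D t) : is_derive (t : (R[i])^o) (1 : (R[i])^o)
    (c i : (R[i])^o -> (R[i])^o) (d i t).
  exact: holomorphic_is_derive (c_holo i) Dt.
have E14 := chart_infty_holomorphic D_open (or_introl erefl) (c_holo 10%N)
  (c_holo 11%N) (c_holo 12%N) (c_holo 13%N) (c_holo 14%N) reg14.
have E20 := chart_infty_holomorphic D_open (or_intror erefl) (c_holo 16%N)
  (c_holo 17%N) (c_holo 18%N) (c_holo 19%N) (c_holo 20%N) reg20.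
have aE t q : D t -> laurent_rhs a t q = 3 * q ^+ 5 / 64 +
    (a (- 3) t * q ^- 3 + a (- 1) t * q^-1 + a 1 t * q + a 3 t * q ^+ 3).
  move=> Dt; have [[am2 a0 a2 a4] _] := E14 _ Dt.
  by rewrite laurent_rhsE am2 a0 a2 a4; ring.
have E3 t (Dt : D t) := chart_zero_equations Dt (Dc 2%N t Dt) (Dc 3%N t Dt)
  reg3 (fun q => aE t q Dt).
have E5 t (Dt : D t) := chart_zero_equations Dt (Dc 4%N t Dt) (Dc 5%N t Dt)
  reg5 (fun q => aE t q Dt).
have c4E t : D t -> - c 2%N t = c 4%N t.
  move=> Dt; have [_ b2 _] := E3 _ Dt; have [_ b4 _] := E5 _ Dt.
  move: (b4); rewrite b2 => /oppr_inj/eqP; rewrite eqf_sqr.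
  by rewrite (negPf (c24 t Dt)) => /eqP ->; rewrite opprK.
(* Differentiating [c 4 = - c 2] gives [a (- 1) = - a (- 1)]. *)
have am1 t : D t -> a (- 1) t = 0.
  move=> Dt; have [_ _ d2] := E3 _ Dt; have [_ _ d4] := E5 _ Dt.
  have : d 4%N t = - d 2%N t.
    exact: (derive_on_eq D_open Dt c4E (is_deriveN (Dc 2%N t Dt))).
  by rewrite d2 d4 => /eqP; rewrite -addr_eq0 -mulr2n mulrn_eq0 => /eqP.
(* The pairs [c 11], [c 13] and [c 17], [c 19] are [k2], [k4] for [e = 8] and [e = - 8]. *)
have c11E t : D t -> c 11%N t = - 8 * (16 * a 3 t).
  by move=> /E14[_ [-> _ _]]; ring.
have c17E t : D t -> - c 11%N t = c 17%N t.
  by move=> Dt; rewrite c11E//; have [_ [-> _ _]] := E20 _ Dt; ring.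
have d17E t (Dt : D t) : d 17%N t = - d 11%N t.
  exact: (derive_on_eq D_open Dt c17E (is_deriveN (Dc 11%N t Dt))).
have c13E t : D t -> c 13%N t =
    4 * (3 * (16 * a 3 t) ^+ 2 - 64 * a 1 t - d 11%N t).
  move=> /E14[_ [_ E _]]; rewrite -/(d 11%N t) in E.
  by apply: (@mulfI _ 2); rewrite ?pnatr_eq0// E; ring.
have c19E t : D t -> c 19%N t =
    - 4 * (3 * (16 * a 3 t) ^+ 2 - 64 * a 1 t + d 11%N t).
  move=> Dt; have [_ [_ E _]] := E20 _ Dt; rewrite -/(d 17%N t) d17E// in E.
  by apply: (@mulfI _ 2); rewrite ?pnatr_eq0// E; ring.
have d13E t : D t -> d 13%N t = - 2 * (16 * a 3 t) * d 11%N t.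
  move=> Dt; have [_ [_ _ E]] := E14 _ Dt.
  by rewrite -/(d 13%N t) -/(d 11%N t) am1// in E; rewrite E; ring.
have d19E t : D t -> d 19%N t = 2 * (16 * a 3 t) * d 11%N t.
  move=> Dt; have [_ [_ _ E]] := E20 _ Dt.
  by rewrite -/(d 19%N t) -/(d 17%N t) am1// d17E// in E; rewrite E; ring.
have const (f f' : R[i] -> R[i]) :
    (forall t, D t -> f' t = 0 /\
      is_derive (t : (R[i])^o) (1 : (R[i])^o)
        (f : (R[i])^o -> (R[i])^o) (f' t)) ->
    forall t, D t -> f t = f t0.
  move=> Df t Dt.
  apply: (derive0_connected D_open D_connected _ Dt Dt0) => s Ds.
  by have [f'0 Dfs] := Df s Ds; rewrite -[X in is_derive _ _ _ X]f'0.
have c2C t : D t -> c 2%N t = c 2%N t0.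
  apply: (const (c 2%N) (d 2%N)) => s Ds; split; last exact: Dc.
  by have [_ _ ->] := E3 _ Ds; exact: am1.
pose kappa := d 11%N t0.
have d11C t : D t -> d 11%N t = kappa.
  (* This sum expresses [d 11] by centres of known derivative, so no second derivative of [c 11] is
     taken. *)
  have S s : D s -> c 13%N s + c 19%N s = - 8 * d 11%N s.
    by move=> Ds; rewrite c13E// c19E//; ring.
  move=> Dt; apply: (@mulfI _ (- 8)); first by rewrite oppr_eq0 pnatr_eq0.
  rewrite -!S//; move: t Dt.
  apply: (const (fun s => c 13%N s + c 19%N s) (fun s => d 13%N s + d 19%N s)).
  move=> s Ds; split; last exact: is_deriveD (Dc 13%N s Ds) (Dc 19%N s Ds).
  by rewrite d13E// d19E//; ring.
have id_derive (t : R[i]) : is_derive (t : (R[i])^o) (1 : (R[i])^o)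
    (fun s : (R[i])^o => s) (1 : (R[i])^o) by exact: is_derive_id.
pose nu := c 11%N t0 - kappa * t0.
have c11C t : D t -> c 11%N t = kappa * t + nu.
  move=> Dt; rewrite -[LHS](subrK (kappa * t)) addrC; congr (_ + _); move: t Dt.
  apply: (const (fun s => c 11%N s - kappa * s)
    (fun s => d 11%N s - kappa * 1)).
  move=> s Ds; split; first by rewrite d11C// mulr1 subrr.
  exact: is_deriveB (Dc 11%N s Ds) (is_deriveZ kappa (id_derive s)).
(* On [D] this equals [512 (a_1 - 4 a_3^2)], written with centres because their derivatives are
   related above. *)
pose H (s : R[i]) := c 11%N s ^+ 2 / 4 - c 13%N s + c 19%N s.
have HC t : D t -> H t = H t0.
  apply: (const H (fun s => 4^-1 * (c 11%N s * d 11%N s + c 11%N s * d 11%N s)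
    - d 13%N s + d 19%N s)) => s Ds; split.
    by rewrite d13E// d19E// c11E//; field.
  have HE : H = (4^-1 : R[i]) \*: ((c 11%N : (R[i])^o -> (R[i])^o)
      * (c 11%N : (R[i])^o -> (R[i])^o)) - (c 13%N : (R[i])^o -> (R[i])^o)
      + (c 19%N : (R[i])^o -> (R[i])^o) :> ((R[i])^o -> (R[i])^o).
    by apply/funext => z; rewrite /H expr2 mulrC.
  rewrite HE; exact: is_deriveD (is_deriveB (is_deriveZ _
    (is_deriveM (Dc 11%N s Ds) (Dc 11%N s Ds))) (Dc 13%N s Ds)) (Dc 19%N s Ds).
(* Matching coefficients: [lam t + mu = 2 a_3 = - c_11 / 64], [alpha = 4 a_3^2 - a_1] and
   [8 beta = a_{-3} = - c_2^2]. *)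
exists (- kappa / 64), (- nu / 64), (- H t0 / (8 * 64)), (- c 2%N t0 ^+ 2 / 8).
have main t q p : D t -> q != 0 ->
    second_order (laurent_rhs a) t (q, p) = second_order
      (takasaki_rhs (- H t0 / (8 * 64)) (- c 2%N t0 ^+ 2 / 8))
      (- kappa / 64 * t + - nu / 64) (q, p).
  move=> Dt q0; congr pair => /=; rewrite aE// am1//.
  have [_ -> _] := E3 _ Dt; rewrite c2C// -(HC t Dt) /H c13E// c19E//.
  have -> : - kappa / 64 * t + - nu / 64 = 2 * a 3 t.
    have /eqP := c11E t Dt; rewrite c11C// -subr_eq0 => /eqP E.
    apply: subr0_eq.
    by rewrite -[RHS](mul0r (- 64^-1)) -[X in _ = X * _]E; field.
  rewrite c11E// /takasaki_rhs; field.
  exact: q0.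
split; first exact: main.
by move=> /takasaki_rescaling; apply=> t q p; exact: main.
Qed.
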